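(* Let $p\in[1,\infty)$ and let $b$ be a graph over $X$ with magnetic potential $\theta$. For all $f\in C_c(X)$, $$\int_0^\infty\Big(\iota_{1,\theta}\big(\Omega_t(|f|^p)\big)+\frac12b\big(\partial\Omega_t(|f|^p)\big)\Big)dt\le\frac{\sqrt{p^2+1}}{2}\sum_{x,y\in X}b(x,y)\,|f(x)-e^{i\theta(x,y)}f(y)|\left(\frac{|f(x)|^p+|f(y)|^p}{2}\right)^{\frac{p-1}{p}}.$$
   Context: Let $X$ be a discrete set and $C_c(X)$ the space of complex-valued functions on $X$ with finite support. A graph over $X$ is a symmetric function $b:X\times X\to[0,\infty)$ with zero diagonal and $\sum_{y\in X}b(x,y)<\infty$ for all $x\in X$; a magnetic potential is an antisymmetric function $\theta:X\times X\to\mathbb{R}/2\pi\mathbb{Z}$. For $g:X\to\mathbb{R}$ and $t\in\mathbb{R}$, $\Omega_t(g)=\{x\in X: g(x)>t\}$. For $W\subseteq X$, $\partial W=(W\times(X\setminus W))\cup((X\setminus W)\times W)$ and $b(A)=\sum_{(x,y)\in A}b(x,y)$ for $A\subseteq X\times X$. For finite $W\subseteq X$ and $\mathbb{T}=\{z\in\mathbb{C}:|z|=1\}$, $$\iota_{1,\theta}(W)=\min_{\tau:W\to\mathbb{T}}\frac12\sum_{x,y\in W}b(x,y)|\tau(x)-e^{i\theta(x,y)}\tau(y)|.$$ For $p=1$ the last factor (exponent $0$) is read as $1$. *)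

(* Defs.v *)
From HB Require Import structures.
From mathcomp Require Import all_boot all_order all_algebra.
From mathcomp Require Import generic_quotient ring_quotient complex.
From mathcomp Require Import all_classical all_reals all_analysis.

Set Implicit Arguments.
Unset Strict Implicit.
Unset Printing Implicit Defensive.

Import Order.TTheory GRing.Theory Num.Theory.
Import ComplexField.Normc.
Import numFieldNormedType.Exports.

Local Open Scope classical_set_scope.
Local Open Scope ring_scope.
Local Open Scope complex_scope.
Local Open Scope quotient_scope.

Section AngleGroup.
Variable R : realType.

Definition two_pi_multiples : {pred R} :=
  [pred x | `[< exists k : int, x = (pi *+ 2) *~ k >]].

Fact two_pi_multiples_zmod_closed : zmod_closed two_pi_multiples.
Proof.
split=> [|x y]; first by apply/asboolP; exists 0%Z; rewrite mulr0z.
move=> /asboolP[k ->] /asboolP[l ->]; apply/asboolP; exists (k - l).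
by rewrite mulrzBr.
Qed.

HB.instance Definition _ :=
  GRing.isZmodClosed.Build R two_pi_multiples two_pi_multiples_zmod_closed.

Definition angle : Type := Quotient.quot two_pi_multiples.
HB.instance Definition _ := GRing.Zmodule.on angle.
HB.instance Definition _ := EqQuotient.on angle.

Definition cis (a : R) : R[i] := cos a +i* sin a.

Definition expi (a : angle) : R[i] := cis (repr a).

Fact cis_period (a : R) (k : int) : cis (a + (pi *+ 2) *~ k) = cis a.
Proof.
have P (n : nat) u : cis (u + (pi *+ 2) *+ n) = cis u.
  elim: n => [|n IH]; first by rewrite mulr0n addr0.
  by rewrite mulrSr addrA /cis cosD2pi sinD2pi; exact: IH.
case: k => n; first exact: P.
by rewrite NegzE mulrNz -[in RHS](subrK (pi *+ 2 *~ n.+1) a) P.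
Qed.

(* [expi] does not depend on the chosen representative. *)
Lemma expi_pi (a : R) : expi (\pi_angle a) = cis a.
Proof.
have : repr (\pi_angle a) == a %[mod angle] by rewrite reprK.
rewrite -Quotient.idealrBE => /asboolP[k e].
by rewrite /expi -(subrK a (repr _)) e addrC cis_period.
Qed.

End AngleGroup.

Section MagneticGraph.
Variables (R : realType) (X : choiceType).

Record is_graph (b : X -> X -> R) : Prop := IsGraph {
  graph_ge0 : forall x y, 0 <= b x y ;
  graph_sym : forall x y, b x y = b y x ;
  graph_diag : forall x, b x x = 0 ;
  graph_summable : forall x, (\esum_(y in [set: X]) (b x y)%:E < +oo)%E
}.

Definition is_magnetic_potential (theta : X -> X -> angle R) : Prop :=
  forall x y, theta x y = - theta y x.

Definition superlevel (g : X -> R) (t : R) : set X := [set x | t < g x].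

Definition boundary (W : set X) : set (X * X) :=
  (W `*` ~` W) `|` (~` W `*` W).

Definition weight (b : X -> X -> R) (A : set (X * X)) : \bar R :=
  (\esum_(e in A) (b e.1 e.2)%:E)%E.

Definition unit_circle : set R[i] := [set z | normc z = 1].

Definition frustration (b : X -> X -> R) (theta : X -> X -> angle R)
    (W : set X) (tau : X -> R[i]) : R :=
  2^-1 * \sum_(x \in W) \sum_(y \in W)
    b x y * normc (tau x - expi (theta x y) * tau y).

(* Only the values of [tau] on [W] matter, and [W] is meant to be finite (a sum
   over [x \in W] is 0 when infinitely many terms are nonzero); the infimum is then a
   minimum, see [iota1_min]. *)
Definition iota1 (b : X -> X -> R) (theta : X -> X -> angle R)
    (W : set X) : R :=
  inf [set frustration b theta W tau | tau in set_fun W unit_circle].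

Section Minimum.
Variables (b : X -> X -> R) (theta : X -> X -> angle R) (W : set X).

Fact cis_unit_circle (a : R) : unit_circle (cis a).
Proof. by rewrite /unit_circle /= cos2Dsin2 sqrtr1. Qed.

Fact unit_circleP (z : R[i]) :
  unit_circle z -> exists2 a : R, - pi <= a <= pi & z = cis a.
Proof.
case: z => u v; rewrite /unit_circle /= => /(congr1 (fun r => r ^+ 2)).
rewrite sqr_sqrtr ?addr_ge0 ?sqr_ge0// expr1n => uv1.
have u1 : -1 <= u <= 1.
  by rewrite -ler_norml -(@ler_pXn2r _ 2)// ?nnegrE// expr1n real_normK ?num_real//
     -uv1 lerDl sqr_ge0.
have v2 : Num.sqrt (1 - u ^+ 2) = `|v| by rewrite -uv1 addrC addKr sqrtr_sqr.
have pi0 := pi_ge0 R.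
have a0 := acos_ge0 u1; have a1 := acos_lepi u1.
have [v0|v0] := leP 0 v.
  exists (acos u); first by rewrite a1 andbT (le_trans _ a0)// oppr_le0.
  by rewrite /cis acosK// sin_acos// v2 ger0_norm.
exists (- acos u); first by rewrite lerN2 a1/= (le_trans _ pi0)// oppr_le0.
by rewrite /cis cosN sinN acosK// sin_acos// v2 ltr0_norm// opprK.
Qed.

Fact cvg_fsbig (T : topologicalType) (t : T) (D : set X) (F : X -> T -> R) :
  finite_set D -> (forall x, {for t, continuous (F x)}) ->
  {for t, continuous (fun s => \sum_(x \in D) F x s)}.
Proof.
move=> fD cF.
rewrite (_ : (fun s => _) = (fun s => \sum_(x <- finmap.enum_fset (fset_set D)) F x s)); last first.
  by apply/funext => s; rewrite fsbig_finite.
by apply: (@cvg_big R _ +%R 0) => [|x _]; [exact: add_continuous|exact: cF].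
Qed.

Fact cvg_normc (T : topologicalType) (t : T) (u v : T -> R) :
  u s @[s --> t] --> u t -> v s @[s --> t] --> v t ->
  normc (u s +i* v s) @[s --> t] --> normc (u t +i* v t).
Proof.
move=> cu cv /=.
have sqr (w : T -> R) : w s @[s --> t] --> w t -> w s ^+ 2 @[s --> t] --> w t ^+ 2.
  by move=> cw; exact: (cvg_comp _ (fun r : R => r ^+ 2) cw (@exprn_continuous R 2 (w t))).
have cD : u s ^+ 2 + v s ^+ 2 @[s --> t] --> u t ^+ 2 + v t ^+ 2.
  by apply: cvgD; exact: sqr.
exact: (cvg_comp _ (@Num.sqrt R) cD (@sqrt_continuous R _)).
Qed.

Fact frustration_cvg (T : topologicalType) (t : T) (a : T -> X -> R) :
  finite_set W -> (forall x, a s x @[s --> t] --> a t x) ->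
  frustration b theta W (fun x => cis (a s x)) @[s --> t] -->
  frustration b theta W (fun x => cis (a t x)).
Proof.
move=> fW px; rewrite /frustration.
pose F x y (s : T) : R :=
  b x y * normc (cis (a s x) - expi (theta x y) * cis (a s y)).
have cF x y : F x y s @[s --> t] --> F x y t.
  rewrite /F /expi; move: (repr _) => r.
  have cc z : cos (a s z) @[s --> t] --> cos (a t z).
    exact: (cvg_comp _ cos (px z) (@continuous_cos R _)).
  have cs z : sin (a s z) @[s --> t] --> sin (a t z).
    exact: (cvg_comp _ sin (px z) (@continuous_sin R _)).
  apply: cvgM; first exact: cvg_cst.
  pose u s : R := cos (a s x) + - (cos r * cos (a s y) - sin r * sin (a s y)).
  pose v s : R := sin (a s x) + - (cos r * sin (a s y) + sin r * cos (a s y)).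
  apply: (@cvg_normc _ _ u v).
    apply: cvgB => //; apply: cvgB; apply: cvgM => //; exact: cvg_cst.
  apply: cvgB => //; apply: cvgD; apply: cvgM => //; exact: cvg_cst.
have cG x : {for t, continuous (fun s => \sum_(y \in W) F x y s)}.
  by apply: (cvg_fsbig fW); exact: cF.
apply: cvgM; first exact: cvg_cst.
exact: (cvg_fsbig fW cG).
Qed.

Fact frustration_continuous : finite_set W ->
  continuous (fun a : prod_topology (fun _ : X => R) =>
    frustration b theta W (fun x : X => cis (a x))).
Proof.
move=> fW a; apply: (@frustration_cvg _ a (fun s : prod_topology _ => s)) => // x.
have := @proj_continuous X (fun=> R) x a; exact.
Qed.

Lemma iota1_min : finite_set W ->
  exists2 tau, set_fun W unit_circle tau &
    iota1 b theta W = frustration b theta W tau /\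
    forall tau', set_fun W unit_circle tau' ->
      frustration b theta W tau <= frustration b theta W tau'.
Proof.
move=> fW.
have fr_ext (s t : X -> R[i]) : (forall x, W x -> s x = t x) ->
    frustration b theta W s = frustration b theta W t.
  move=> st; rewrite /frustration; congr (_ * _).
  apply: eq_fsbigr => x /set_mem Wx; apply: eq_fsbigr => y /set_mem Wy.
  by rewrite !st.
pose K : set (prod_topology (fun _ : X => R)) :=
  [set a | forall x, `[- pi, pi]%classic (a x)].
have cK : compact K.
  exact: (@tychonoff X (fun=> R) (fun=> `[- pi, pi]%classic) (fun=> @segment_compact R _ _)).
have K0 : K !=set0.
  by exists (fun=> 0) => x /=; rewrite in_itv/= oppr_le0 pi_ge0.
have [a /set_mem Ka amin] := compact_EVT_min K0 cK
  (continuous_subspaceT (frustration_continuous fW)).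
exists (fun x => cis (a x)); first by move=> x _; exact: cis_unit_circle.
set m := frustration _ _ _ _.
have lb (tau' : X -> R[i]) : set_fun W unit_circle tau' ->
    m <= frustration b theta W tau'.
  move=> tau'W.
  have /choice[a' a'P] (x : X) :
      exists r : R, - pi <= r <= pi /\ (W x -> tau' x = cis r).
    have [/tau'W/unit_circleP[r rpi ->]|nW] := pselect (W x).
      by exists r.
    by exists 0; split=> //; rewrite oppr_le0 pi_ge0.
  rewrite (fr_ext tau' (fun x => cis (a' x))); last by move=> x /(a'P x).2.
  by apply: amin; apply/mem_set => x /=; rewrite in_itv/= (a'P x).1.
split=> //; apply/eqP; rewrite eq_le; apply/andP; split.
  apply: ge_inf; last by exists (fun x => cis (a x)) => // x _; exact: cis_unit_circle.
  by exists m => _ [tau' /lb ? <-].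
apply: lb_le_inf; last by move=> _ [tau' /lb ? <-].
by exists m, (fun x => cis (a x)) => // x _; exact: cis_unit_circle.
Qed.

End Minimum.

End MagneticGraph.

(* Main.v *)
Require Import Defs.
From HB Require Import structures.
From mathcomp Require Import all_boot all_order all_algebra.
From mathcomp Require Import generic_quotient ring_quotient complex.
From mathcomp Require Import all_classical all_reals all_analysis.
From mathcomp Require Import measurable_realfun ring lra.

Set Implicit Arguments.
Unset Strict Implicit.
Unset Printing Implicit Defensive.

Import Order.TTheory GRing.Theory Num.Theory.
Import ComplexField.Normc.
Import numFieldNormedType.Exports.

Local Open Scope classical_set_scope.
Local Open Scope ring_scope.
Local Open Scope complex_scope.

(** Write f = |f| tau with tau of modulus one on the support of f, and test
iota1 on every superlevel set with this single tau: no optimal choice is needed.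
The integrand is then at most half of a sum over the edges (x, y) of
[b x y * k t], where, with m and M the minimum and maximum of |f x|^p and
|f y|^p, and delta = |tau x - e^(i theta) tau y|, the function k equals delta
on [0, m[ (both ends of the edge lie in the superlevel set) and 1 on [m, M[
(exactly one end does, so the edge is in the boundary).  Integrating in t gives
[delta * m + (M - m)] for each edge, and what is left is an inequality about
two complex numbers ([edge_le]).

That inequality is Cauchy-Schwarz applied to two estimates.  For
0 <= c <= a and mean Q = (a^p + c^p) / 2,
- a^p - c^p <= p (a - c) Q^((p-1)/p)  ([powR_sub_le_mean]), and
- c^p <= c Q^((p-1)/p), where c <= sqrt (a c).
Since |z - e^(i theta) w|^2 = (a - c)^2 + a c delta^2 for |z| = a, |w| = c,
the combination 1 * (c delta) + p * (a - c) is at most sqrt (1 + p^2) times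
|z - e^(i theta) w|.

Two points of measure theory.  Measurability of t |-> iota1 of the superlevel
set at t is avoided: integrals of nonnegative functions are suprema over simple
functions below, hence monotone without it
([ge0_le_integral_nonmeasurable]).  The sum over edges may be uncountable, but
because f has finite support only finitely many functions k occur, so grouping
the edges by k turns it into a finite sum, which commutes with the integral
([integral_esum_finite_range]). *)

(** * Unordered sums and integrals *)

Section Esum.
Context {R : realType} {T : choiceType}.
Local Open Scope ereal_scope.

Lemma ge0_esumZl (D : set T) (a : T -> \bar R) (c : R) :
  (forall i, 0 <= a i) -> (0 <= c)%R ->
  \esum_(i in D) (c%:E * a i) = c%:E * \esum_(i in D) a i.
Proof.
move=> a0 c0; rewrite /esum -ereal_supZl//; last first.
  by apply/set0P; exists (\sum_(i \in set0) a i); exists set0 => //; exact: fsets_set0.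
congr ereal_sup; rewrite image_comp; apply: eq_imagel => F _ /=.
by rewrite ge0_mule_fsumr.
Qed.

Lemma esum_fibers (J : choiceType) (phi : T -> J) (s : seq J) (a : T -> \bar R) :
  uniq s -> (forall i, phi i \in s) -> (forall i, 0 <= a i) ->
  \esum_(i in [set: T]) a i = \sum_(j <- s) \esum_(i in phi @^-1` [set j]) a i.
Proof.
move=> us phis a0.
rewrite (eq_bigr (fun j => \esum_(i in [set: T])
  (fun i j => if i \in phi @^-1` [set j] then a i else 0) i j)); last first.
  by move=> j _; rewrite [LHS]esum_mkcond.
rewrite -(@esum_sum _ _ _ _ s xpredT); last by move=> i j _ _; case: ifP.
apply: eq_esum => i _; rewrite (bigD1_seq (phi i))//= mem_set// big1 ?adde0// => j ji.
by rewrite memNset// => /esym/eqP; rewrite (negbTE ji).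
Qed.

End Esum.

Section Integral.
Context {d : measure_display} {T : measurableType d} {R : realType}.
Variable mu : {measure set T -> \bar R}.
Local Open Scope ereal_scope.

(** The integral of a nonnegative function is the supremum of the integrals of
the simple functions below it, and this supremum grows with the function. *)
Lemma ge0_le_integral_nonmeasurable (D : set T) (f g : T -> \bar R) :
  (forall x, D x -> 0 <= f x) -> (forall x, D x -> f x <= g x) ->
  \int[mu]_(x in D) f x <= \int[mu]_(x in D) g x.
Proof.
move=> f0 fg.
have g0 x : D x -> 0 <= g x by move=> Dx; exact: le_trans (f0 x Dx) (fg x Dx).
rewrite !ge0_integralE//; apply: ereal_sup_le => _ [h/= hf <-]; exists h => // x.
apply: le_trans (hf x) _; rewrite /patch; case: ifPn => // /set_mem; exact: fg.
Qed.

(** The index set may be uncountable, where monotone convergence does not apply;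
finiteness of the set of integrands replaces it, through the finite sum over
the fibers of [k]. *)
Lemma integral_esum_finite_range (I : choiceType) (D : set T)
    (b : I -> R) (k : I -> T -> R) :
  measurable D -> (forall e, (0 <= b e)%R) -> finite_set (range k) ->
  (forall e t, (0 <= k e t)%R) ->
  (forall e, measurable_fun D (k e)) ->
  (forall e, \int[mu]_(t in D) (k e t)%:E \is a fin_num) ->
  (\int[mu]_(t in D) \esum_(e in [set: I]) ((b e)%:E * (k e t)%:E)) =
  \esum_(e in [set: I]) ((b e)%:E * (\int[mu]_(t in D) (k e t)%:E)).
Proof.
move=> mD b0 fk k0 mk ik.
have [[e0 _]|I0] := pselect (exists e : I, True); last first.
  have -> : [set: I] = set0.
    by apply/seteqP; split=> // e _; apply: I0; exists e.
  by rewrite esum_set0; apply: integral0_eq => t _; rewrite esum_set0.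
(* [phi] picks one index in each fiber of [k]; it ranges over a finite set and
   does not change [k]. *)
pose rep (g : T -> R) := xget e0 [set e | k e = g].
pose phi e := rep (k e).
have kphi e : k (phi e) = k e by apply: (@xgetPex _ e0 [set e' | k e' = k e]); exists e.
have fphi : finite_set (range phi).
  have -> : range phi = rep @` range k by rewrite image_comp.
  exact: finite_image.
set s := finmap.enum_fset (fset_set (range phi)).
have phis e : phi e \in s.
  by have := in_fset_set fphi (phi e); rewrite mem_set; [move=> ->|exists e].
pose B j := \esum_(e in phi @^-1` [set j]) (b e)%:E.
have B0 j : 0 <= B j by apply: esum_ge0 => e _; rewrite lee_fin.
have fibers (a : I -> R) : (forall e, (0 <= a e)%R) -> (forall e, a (phi e) = a e) ->
    \esum_(e in [set: I]) ((b e)%:E * (a e)%:E) = \sum_(j <- s) B j * (a j)%:E.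
  move=> a0 aphi.
  rewrite (@esum_fibers _ _ _ phi s) ?finmap.fset_uniq//; last first.
    by move=> e; rewrite mule_ge0// lee_fin.
  apply: eq_bigr => j _; rewrite muleC -ge0_esumZl//.
  by apply: eq_esum => e /= je; rewrite -je aphi muleC.
transitivity (\int[mu]_(t in D) \sum_(j <- s) B j * (k j t)%:E).
  by apply: eq_integral => t _; apply: fibers => e //; rewrite kphi.
rewrite ge0_integral_sum//; last 2 first.
- by move=> j; apply/measurable_funeM/measurable_EFinP.
- by move=> j t _; rewrite mule_ge0// lee_fin.
transitivity (\sum_(j <- s) B j * (fine (\int[mu]_(t in D) (k j t)%:E))%:E).
  apply: eq_bigr => j _; rewrite ge0_integralZl ?fineK//.
  - exact/measurable_EFinP.
  - by move=> t _; rewrite lee_fin.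
rewrite -fibers.
- by apply: eq_esum => e _; rewrite fineK.
- by move=> e; apply: fine_ge0; apply: integral_ge0 => t _; rewrite lee_fin.
- by move=> e; rewrite kphi.
Qed.

End Integral.

(** * A mean value inequality for powers *)

Lemma is_derive_powR1D (R : realType) (r s h : R) : 0 < 1 + s * h ->
  is_derive h 1 (fun h => (1 + s * h) `^ r) (s * (r * (1 + s * h) `^ (r - 1))).
Proof.
move=> h0.
have hI : 1 + s * h \in `]0, +oo[ by rewrite in_itv/= h0.
have d1 : is_derive (1 + s * h) 1 (fun x : R => x `^ r) (r * (1 + s * h) `^ (r - 1)).
  apply: DeriveDef; first exact: derivable_powR.
  by rewrite -derive1E powR_derive1.
have d2 : is_derive h 1 (fun h => 1 + s * h) s.
  have := @is_deriveD _ _ _ (cst (1 : R)) (fun h : R => s * h) h 1 0 s.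
  rewrite add0r; apply.
  by have := @is_deriveZ _ _ _ (@id R) s h 1 1; rewrite /GRing.scale/= mulr1; apply.
by rewrite mulrC; exact: (@is_derive1_comp _ (fun x => x `^ r) (fun h => 1 + s * h)).
Qed.

(** The derivative of (1 + h)^r - (1 - h)^r - 2 r h is
r (u + v - 2) with u = (1 + h)^(r - 1) and v = (1 - h)^(r - 1); as
u v = (1 - h^2)^(r - 1) >= 1, the arithmetic-geometric mean inequality makes it
nonnegative.  The strict bound h < 1 keeps the base 1 - h away from 0, where
v is singular when r < 1. *)
Lemma powR_symmetric_diff_lt1 (R : realType) (r h : R) : 0 < r <= 1 -> 0 <= h < 1 ->
  2 * r * h <= (1 + h) `^ r - (1 - h) `^ r.
Proof.
move=> /andP[r0 r1] /andP[h0 h1].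
(* The factors 1 and -1 match the form in [is_derive_powR1D]. *)
pose phi := fun x : R => ((1 + 1 * x) `^ r - (1 + (-1) * x) `^ r) - (2 * r) * x.
have dphi (x : R) : 0 <= x -> x <= h -> is_derive x 1 phi
   (r * ((1 + x) `^ (r - 1) + (1 - x) `^ (r - 1) - 2)).
  move=> x0 xh.
  have dp : is_derive x 1 (fun x => (1 + 1 * x) `^ r) (1 * (r * (1 + 1 * x) `^ (r - 1))).
    by apply: is_derive_powR1D; lra.
  have dn : is_derive x 1 (fun x => (1 + (-1) * x) `^ r) (-1 * (r * (1 + (-1) * x) `^ (r - 1))).
    by apply: is_derive_powR1D; lra.
  have dl : is_derive x 1 (fun x => (2 * r) * x) (2 * r).
    by have := @is_deriveZ _ _ _ (@id R) (2 * r) x 1 1; rewrite /GRing.scale/= mulr1; apply.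
  have := is_deriveB (is_deriveB dp dn) dl.
  set u := (X in is_derive x 1 phi X -> _).
  set v := (X in _ -> is_derive x 1 phi X).
  by have -> : u = v by rewrite /u /v !mul1r !mulN1r; ring.
have phi_ge0 : phi 0 <= phi h.
  apply: (@ger0_derive1_ndecr R phi 0 h) => //.
  - by move=> x /[!in_itv]/= /andP[x0 xh]; have [] := dphi x (ltW x0) (ltW xh).
  - move=> x /[!in_itv]/= /andP[x0 xh].
    rewrite derive1E; have [_ ->] := dphi x (ltW x0) (ltW xh).
    apply: mulr_ge0; first exact: ltW.
    set u := _ `^ _; set v := _ `^ _.
    have u0 : 0 < u by apply: powR_gt0; lra.
    have v0 : 0 < v by apply: powR_gt0; lra.
    have uv : 1 <= u * v.
      rewrite -powRM; [|lra|lra].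
      rewrite -[leLHS](powRr0 ((1 + x) * (1 - x))).
      by apply: ger_powR; [apply/andP; split; nra|lra].
    rewrite subr_ge0 -(@ler_pXn2r _ 2) ?nnegrE//; [|lra].
    have := sqr_ge0 (u - v); nra.
  - apply: derivable_within_continuous => x /[!in_itv]/= /andP[x0 xh].
    by have [] := dphi x x0 xh.
move: phi_ge0; rewrite /phi !mulr0 !addr0 subrr subr0 mul1r mulN1r; lra.
Qed.

(** At h = 1 the claim is 2 r <= 2^r: were it false, h = 2^r / (2 r) < 1 would
give 2^r <= (1 + h)^r < 2^r. *)
Lemma powR_symmetric_diff (R : realType) (r h : R) : 0 < r <= 1 -> 0 <= h <= 1 ->
  2 * r * h <= (1 + h) `^ r - (1 - h) `^ r.
Proof.
move=> r01 /andP[h0]; rewrite le_eqVlt => /predU1P[->|h1]; last first.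
  by apply: powR_symmetric_diff_lt1; rewrite ?h0.
have /andP[r0 r1] := r01.
rewrite subrr powR0 ?gt_eqF// subr0 mulr1 leNgt; apply/negP => lt2r.
have two0 : 0 < (1 + 1 : R) `^ r by apply: powR_gt0; lra.
pose k := (1 + 1) `^ r / (2 * r).
have k1 : k < 1 by rewrite ltr_pdivrMr; lra.
have k0 : 0 <= k by apply: divr_ge0; lra.
have := powR_symmetric_diff_lt1 r01 (introT andP (conj k0 k1)).
rewrite [2 * r * k]mulrC divfK; last by rewrite gt_eqF//; lra.
have : (1 + k) `^ r < (1 + 1) `^ r by apply: gt0_ltr_powR; rewrite ?nnegrE//; lra.
have := powR_ge0 (1 - k) r; lra.
Qed.

(** After scaling the mean of a^p and c^p to 1 these powers become 1 + h and
1 - h, and the claim is [powR_symmetric_diff] with r = 1 / p. *)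
Lemma powR_sub_le_mean (R : realType) (p a c : R) : 1 <= p -> 0 <= c -> c <= a ->
  a `^ p - c `^ p <= p * (a - c) * ((a `^ p + c `^ p) / 2) `^ ((p - 1) / p).
Proof.
move=> p1 c0 ca; have p0 : 0 < p by lra.
have a0 : 0 <= a by lra.
have [az|a_neq0] := eqVneq a 0.
  have -> : c = a by lra.
  by rewrite !subrr mulr0 mul0r.
set A := a `^ p; set C := c `^ p.
have A0 : 0 < A by apply: powR_gt0; rewrite lt_neqAle eq_sym a_neq0.
have C0 : 0 <= C by exact: powR_ge0.
have CA : C <= A by apply: ge0_ler_powR; rewrite ?nnegrE//; lra.
have rootK x : 0 <= x -> (x `^ p) `^ p^-1 = x.
  by move=> x0; rewrite -powRrM divff ?gt_eqF// powRr1.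
pose M := (A + C) / 2; pose h := (A - C) / (A + C).
have M0 : 0 < M by rewrite /M; lra.
have AE : A = M * (1 + h) by rewrite /M /h; field; lra.
have CE : C = M * (1 - h) by rewrite /M /h; field; lra.
have h0 : 0 <= h by apply: divr_ge0; lra.
have h1 : h <= 1 by rewrite ler_pdivrMr; lra.
have aE : a = M `^ p^-1 * (1 + h) `^ p^-1 by rewrite -powRM ?(ltW M0)//; [rewrite -AE rootK|lra].
have cE : c = M `^ p^-1 * (1 - h) `^ p^-1 by rewrite -powRM ?(ltW M0)//; [rewrite -CE rootK|lra].
have gap : 2 * p^-1 * h <= (1 + h) `^ p^-1 - (1 - h) `^ p^-1.
  by apply: powR_symmetric_diff; rewrite ?h0// invr_gt0 p0 invf_le1.
have MM : M `^ p^-1 * M `^ ((p - 1) / p) = M.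
  rewrite -powRD; last by apply/implyP => _; rewrite gt_eqF.
  have -> : p^-1 + (p - 1) / p = 1 by field; rewrite gt_eqF.
  by rewrite powRr1 ?ltW.
rewrite -/M.
have -> : p * (a - c) * M `^ ((p - 1) / p) = p * M * ((1 + h) `^ p^-1 - (1 - h) `^ p^-1).
  by rewrite [in LHS]aE [in LHS]cE -[in RHS]MM; ring.
have -> : A - C = p * M * (2 * p^-1 * h).
  by rewrite [in LHS]AE [in LHS]CE; field; rewrite gt_eqF.
by rewrite ler_pM2l// mulr_gt0.
Qed.

(** * The inequality for one edge *)

(** With Q the mean of a^p and c^p, both c^p and a^p - c^p are bounded by
multiples of Q^((p-1)/p), with factors c and p (a - c).  The resulting
combination c delta + p (a - c) is bounded by Cauchy-Schwarz, using
c^2 <= a c. *)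
Lemma weighted_phase_le (R : realType) (p a c delta D : R) : 1 <= p ->
  0 <= c -> c <= a -> 0 <= delta -> 0 <= D ->
  D ^+ 2 = (a - c) ^+ 2 + a * c * delta ^+ 2 ->
  c `^ p * delta + (a `^ p - c `^ p) <=
  Num.sqrt (p ^+ 2 + 1) * D * ((a `^ p + c `^ p) / 2) `^ ((p - 1) / p).
Proof.
move=> p1 c0 ca delta0 D0 D2; have p0 : 0 < p by lra.
set M := _ `^ ((p - 1) / p).
have M0 : 0 <= M by exact: powR_ge0.
have cpM : c `^ p <= c * M.
  rewrite -(mulr_powRB1 c0 p0) ler_wpM2l//.
  have -> : c `^ (p - 1) = (c `^ p) `^ ((p - 1) / p).
    by rewrite -powRrM mulrC divfK ?gt_eqF.
  have cap : c `^ p <= a `^ p by apply: ge0_ler_powR; rewrite ?nnegrE//; lra.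
  have cp0 := powR_ge0 c p.
  by apply: ge0_ler_powR; rewrite ?nnegrE//; [apply: divr_ge0; lra|lra|lra].
apply: (@le_trans _ _ ((c * delta + p * (a - c)) * M)).
  rewrite mulrDl lerD//; last exact: powR_sub_le_mean.
  by rewrite mulrAC ler_wpM2r.
rewrite ler_wpM2r//.
rewrite -(@ler_pXn2r _ 2) ?nnegrE//; last 2 first.
- apply: addr_ge0; apply: mulr_ge0; lra.
- by rewrite mulr_ge0// sqrtr_ge0.
rewrite exprMn sqr_sqrtr ?D2; last by have := sqr_ge0 p; lra.
(* The two facts below are the Lagrange remainder of Cauchy-Schwarz and the
   gain in replacing c^2 by a c. *)
have := sqr_ge0 ((a - c) - p * (c * delta)).
have : 0 <= (p ^+ 2 + 1) * (c * (a - c) * delta ^+ 2).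
  by rewrite !mulr_ge0// ?sqr_ge0 ?subr_ge0//; have := sqr_ge0 p; lra.
nra.
Qed.

(** The cross term is the same multiple of the inner product of u and v on both
sides. *)
Lemma normc_polar_sub (R : realType) (u v : R[i]) (a c : R) :
  normc u = 1 -> normc v = 1 ->
  normc (a%:C * u - c%:C * v) ^+ 2 = (a - c) ^+ 2 + a * c * normc (u - v) ^+ 2.
Proof.
have sqE (x y : R) : Num.sqrt (x ^+ 2 + y ^+ 2) ^+ 2 = x ^+ 2 + y ^+ 2.
  by rewrite sqr_sqrtr// addr_ge0 ?sqr_ge0.
case: u v => [u1 u2] [v1 v2] /(congr1 (fun x => x ^+ 2)) + /(congr1 (fun x => x ^+ 2)).
rewrite /= !sqE expr1n => u_1 v_1.
transitivity ((a - c) ^+ 2 + a * c * ((u1 - v1) ^+ 2 + (u2 - v2) ^+ 2)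
  + (a * (a - c)) * (u1 ^+ 2 + u2 ^+ 2 - 1) + (c * (c - a)) * (v1 ^+ 2 + v2 ^+ 2 - 1)).
  by ring.
by rewrite u_1 v_1; ring.
Qed.

Definition phase (R : realType) (z : R[i]) : R[i] := (normc z)^-1%:C * z.

Lemma phaseK (R : realType) (z : R[i]) : (normc z)%:C * phase z = z.
Proof.
have [->|z0] := eqVneq z 0; first by rewrite /phase !mulr0.
rewrite /phase mulrA -rmorphM divff ?mul1r//.
by apply: contra z0 => /eqP/eq0_normc ->.
Qed.

Lemma normc_ge0 (R : realType) (z : R[i]) : 0 <= normc z.
Proof. by case: z => x y; exact: sqrtr_ge0. Qed.

Lemma normc_real (R : realType) (x : R) : normc x%:C = `|x|.
Proof. by rewrite /= expr0n/= addr0 sqrtr_sqr. Qed.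

Lemma normc_phase (R : realType) (z : R[i]) : z != 0 -> normc (phase z) = 1.
Proof.
move=> z0; rewrite /phase normcM normc_real.
rewrite ger0_norm ?invr_ge0 ?normc_ge0// mulVf//.
by apply: contra z0 => /eqP/eq0_normc ->.
Qed.

Lemma normc_expi (R : realType) (x : angle R) : normc (expi x) = 1.
Proof. exact: cis_unit_circle. Qed.

(** This is [weighted_phase_le] for the larger and the smaller of |z| and |w|.
Edges with an end outside the support are included: there the minimum is 0 and
cancels the phase term, and the identity for |z - e^(i al) w|^2 holds because
its mixed term vanishes. *)
Lemma edge_le (R : realType) (p : R) (z w : R[i]) (al : angle R) : 1 <= p ->
  let A := normc z `^ p in let C := normc w `^ p in
  normc (phase z - expi al * phase w) * Num.min A C + (Num.max A C - Num.min A C)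
  <= Num.sqrt (p ^+ 2 + 1) * (normc (z - expi al * w) * ((A + C) / 2) `^ ((p - 1) / p)).
Proof.
move=> p1 /=; set A := _ `^ p; set C := _ `^ p.
have p0 : 0 < p by lra.
have zn := normc_ge0 z; have wn := normc_ge0 w.
have A0 : 0 <= A by exact: powR_ge0.
have C0 : 0 <= C by exact: powR_ge0.
have zE : z = (normc z)%:C * phase z by rewrite phaseK.
have wE : expi al * w = (normc w)%:C * (expi al * phase w) by rewrite mulrCA phaseK.
pose delta := normc (phase z - expi al * phase w).
have delta0 : 0 <= delta by exact: normc_ge0.
have DE : normc (z - expi al * w) ^+ 2 =
   (normc z - normc w) ^+ 2 + normc z * normc w * delta ^+ 2.
  have [->|z0] := eqVneq z 0.
    by rewrite normc0 sub0r normcN normcM normc_expi; ring.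
  have [->|w0] := eqVneq w 0.
    by rewrite normc0 mulr0 subr0; ring.
  rewrite {1}zE wE normc_polar_sub//; first exact: normc_phase.
  by rewrite normcM normc_expi normc_phase// mulr1.
have [zw|wz] := leP (normc z) (normc w).
- have AC : A <= C by apply: ge0_ler_powR; rewrite ?nnegrE//; lra.
  rewrite (min_l AC) (max_r AC) -/delta [delta * _]mulrC mulrA [A + C]addrC.
  apply: weighted_phase_le => //; first exact: normc_ge0.
  by rewrite DE; ring.
- have CA : C <= A by apply: ge0_ler_powR; rewrite ?nnegrE//; lra.
  rewrite (min_r CA) (max_l CA) -/delta [delta * _]mulrC mulrA.
  by apply: weighted_phase_le => //; [exact: ltW|exact: normc_ge0].
Qed.

(** * The contribution of one edge at one level *)

Section LayerCake.
Context {R : realType}.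

(** For an edge at whose ends a function takes the values m <= M, the level t
leaves both ends in the superlevel set when t < m, and separates them when
m <= t < M; delta and 1 are the costs of these two events. *)
Definition layer (delta m M t : R) : R :=
  delta * \1_(`[0, m[%classic) t + \1_(`[m, M[%classic) t.

Lemma layer_ge0 (delta m M t : R) : 0 <= delta -> 0 <= layer delta m M t.
Proof. by move=> d0; rewrite addr_ge0// ?mulr_ge0// indicE; case: (_ \in _). Qed.

Lemma layerE (delta m M t : R) : 0 <= t ->
  layer delta m M t = delta * (t < m)%R%:R + (m <= t < M)%R%:R.
Proof.
by move=> t0; rewrite /layer !indicE !mem_setE !in_itv/= t0.
Qed.

Lemma layer0 (delta M : R) : layer delta 0 M = layer 0 0 M.
Proof.
by apply/funext => t; rewrite /layer set_itvco0 indic0 /= !mulr0.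
Qed.

Lemma measurable_layer (delta m M : R) (D : set R) : measurable_fun D (layer delta m M).
Proof.
apply: measurable_funD; last exact: measurable_indic.
by apply: measurable_funM => //; exact: measurable_indic.
Qed.

Lemma integral_layer (delta m M : R) : 0 <= delta -> 0 <= m <= M ->
  (\int[lebesgue_measure]_(t in `[0%R, +oo[) (layer delta m M t)%:E =
   (delta * m + (M - m))%:E)%E.
Proof.
move=> d0 /andP[m0 mM].
have ind (u v : R) : 0 <= u <= v ->
    (\int[lebesgue_measure]_(t in `[0%R, +oo[) (\1_(`[u, v[%classic) t)%:E = (v - u)%:E)%E.
  move=> /andP[u0 uv]; rewrite integral_indic//.
  rewrite (_ : _ `&` _ = `[u, v[%classic); last first.
    apply/seteqP; split=> x /=; first by case.
    by rewrite !in_itv/= andbT => /andP[ux xv]; split; [exact/andP|exact: le_trans ux].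
  rewrite -[LHS]/(lebesgue_measure `[u, v[%classic) lebesgue_measure_itv /= lte_fin.
  case: ltP => // vu.
  by rewrite (_ : v = u) ?subrr//; apply/eqP; rewrite eq_le vu.
transitivity (\int[lebesgue_measure]_(t in `[0%R, +oo[)
    (delta%:E * (\1_(`[0, m[%classic) t)%:E + (\1_(`[m, M[%classic) t)%:E))%E.
  by apply: eq_integral => t _; rewrite -EFinM -EFinD.
pose D : set (measurableTypeR R) := `[0%R, +oo[%classic.
have ind0 (A : set R) (t : R) : (0 <= (\1_A t)%:E :> \bar R)%E.
  by rewrite lee_fin indicE; case: (_ \in _).
have mind (u v : R) : measurable_fun D
    (fun t : measurableTypeR R => (\1_(`[u, v[%classic) t)%:E : \bar R).
  by apply/measurable_EFinP; exact: measurable_indic.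
have mD : measurable D by exact: measurable_itv.
rewrite (@ge0_integralD _ _ _ lebesgue_measure D mD); last 4 first.
- by move=> t _; apply: mule_ge0.
- exact: measurable_funeM.
- by [].
- exact: mind.
rewrite (@ge0_integralZl_EFin _ _ _ lebesgue_measure D mD); last 3 first.
- by move=> t _; exact: ind0.
- exact: mind.
- exact: d0.
by rewrite !ind ?m0 ?lexx// subr0 -EFinM -EFinD.
Qed.

End LayerCake.

(** * From superlevel sets to edges *)

Section Graph.
Context (R : realType) (X : choiceType) (b : X -> X -> R) (theta : X -> X -> angle R).
Context (b0 : forall x y, 0 <= b x y).

Lemma frustration_esum (W : set X) (tau : X -> R[i]) : finite_set W ->
  ((frustration b theta W tau)%:E = (2^-1)%:E * \esum_(e in W `*` W)
    (b e.1 e.2 * normc (tau e.1 - expi (theta e.1 e.2) * tau e.2))%:E)%E.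
Proof.
move=> fW; rewrite esum_fset; last 2 first.
- exact: finite_setX.
- by move=> e _; rewrite lee_fin mulr_ge0// normc_ge0.
by rewrite /frustration (pair_fsbig _ (fun x y => _))// fsumEFin ?EFinM//; exact: finite_setX.
Qed.

Lemma iota1_le (W : set X) (tau : X -> R[i]) : finite_set W ->
  set_fun W (@unit_circle R) tau -> iota1 b theta W <= frustration b theta W tau.
Proof. by move=> fW tauW; have [t _ [-> h]] := iota1_min b theta fW; exact: h. Qed.

Lemma iota1_ge0 (W : set X) : finite_set W -> 0 <= iota1 b theta W.
Proof.
move=> fW; have [tau _ [-> _]] := iota1_min b theta fW.
rewrite -lee_fin frustration_esum// mule_ge0//; apply: esum_ge0 => e _.
by rewrite lee_fin mulr_ge0// normc_ge0.
Qed.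

Context (f : X -> R[i]) (g : X -> R).
Context (hf : finite_set [set x | f x != 0]).
Context (g0 : forall x, 0 <= g x) (gf : forall x, f x = 0 -> g x = 0).

Lemma superlevel_support t x : 0 <= t -> superlevel g t x -> f x != 0.
Proof.
move=> t0 tx; apply/eqP => /gf gx.
by move: tx; rewrite /superlevel/= gx ltNge t0.
Qed.

Lemma finite_superlevel t : 0 <= t -> finite_set (superlevel g t).
Proof. by move=> t0; apply: sub_finite_set hf => x; exact: superlevel_support. Qed.

Definition edge_layer (e : X * X) : R -> R :=
  layer (normc (phase (f e.1) - expi (theta e.1 e.2) * phase (f e.2)))
    (Num.min (g e.1) (g e.2)) (Num.max (g e.1) (g e.2)).

(** The phase of f is the competitor in the minimum defining iota1; the edges
inside the superlevel set and those of its boundary are disjoint, and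
[edge_layer] is the sum of the two contributions. *)
Lemma iota1_boundary_le_layers t : 0 <= t ->
  ((iota1 b theta (superlevel g t))%:E
    + (2^-1)%:E * weight b (boundary (superlevel g t))
   <= \esum_(e in [set: X * X])
        ((2^-1 * b e.1 e.2)%:E * (edge_layer e t)%:E))%E.
Proof.
pose tau x := phase (f x).
pose m e := Num.min (g e.1) (g e.2); pose M e := Num.max (g e.1) (g e.2).
move=> t0; set W := superlevel g t.
have tauW : set_fun W (@unit_circle R) tau.
  by move=> x Wx; apply: normc_phase; exact: superlevel_support Wx.
apply: (@le_trans _ _
  ((frustration b theta W tau)%:E + (2^-1)%:E * weight b (boundary W))%E).
  by apply: leeD => //; rewrite lee_fin iota1_le//; exact: finite_superlevel.
rewrite frustration_esum//; last exact: finite_superlevel.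
rewrite -ge0_muleDr; last 2 first.
- by apply: esum_ge0 => e _; rewrite lee_fin mulr_ge0// normc_ge0.
- by apply: esum_ge0 => e _; rewrite lee_fin.
rewrite /weight esum_mkcond [X in (_ * (_ + X))%E]esum_mkcond -esumD; last 2 first.
- by move=> e _; case: ifP => // _; rewrite lee_fin mulr_ge0// normc_ge0.
- by move=> e _; case: ifP => // _; rewrite lee_fin.
rewrite -ge0_esumZl//; last first.
  by move=> e; rewrite adde_ge0//; case: ifP => // _; rewrite lee_fin ?mulr_ge0// normc_ge0.
apply: le_esum => -[x y] _ /=; rewrite [in leRHS]EFinM -[leRHS]muleA lee_pmul2l//.
have WxE z : (z \in W) = (t < g z) by rewrite /W/superlevel mem_setE.
have WWE : ((x, y) \in W `*` W) = (t < m (x, y)) by rewrite in_setX !WxE lt_min.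
have dWE : ((x, y) \in boundary W) = (m (x, y) <= t < M (x, y)).
  rewrite /boundary in_setU !in_setX !in_setC !WxE -!leNgt/= ge_min lt_max.
  by case: (ltP t (g x)); case: (ltP t (g y)).
rewrite /edge_layer layerE// -/(m (x, y)) -/(M (x, y)) WWE dWE -EFinM.
case: (t < m (x, y)); case: (m (x, y) <= t < M (x, y));
  by rewrite -?EFinD ?add0e ?adde0 lee_fin ?mulr1 ?mulr0 ?addr0 ?add0r ?mulrDr ?mulr1 ?mulr0.
Qed.

(** Outside the finite set of edges with both ends in the support, the minimum
of [g] over the edge is 0 and the layer depends on one value of [g] only. *)
Lemma finite_edge_layers : finite_set (range edge_layer).
Proof.
pose S := [set x | f x != 0].
have fS : finite_set S by [].
have fimg : finite_set (edge_layer @` (S `*` S)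
    `|` ((fun x => layer 0 0 (g x)) @` S `|` [set layer 0 0 0])).
  rewrite !finite_setU; split; last split.
  - by apply: finite_image; exact: finite_setX.
  - exact: finite_image.
  - exact: finite_set1.
apply: sub_finite_set fimg => _ [e _ <-]; case: e => x y.
have [x0|x0] := eqVneq (f x) 0; have [y0|y0] := eqVneq (f y) 0.
- by right; right; rewrite /edge_layer/= !gf// minxx maxxx layer0.
- right; left; exists y => //.
  by rewrite /edge_layer/= (gf x0) (min_l (g0 y)) (max_r (g0 y)) layer0.
- right; left; exists x => //.
  by rewrite /edge_layer/= (gf y0) (min_r (g0 x)) (max_l (g0 x)) layer0.
- by left; exists (x, y).
Qed.

End Graph.

Theorem lemma3p9 (R : realType) (X : choiceType) (p : R) (hp : 1 <= p)
    (b : X -> X -> R) (hb : is_graph b)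
    (theta : X -> X -> angle R) (htheta : is_magnetic_potential theta)
    (f : X -> R[i]) (hf : finite_set [set x | f x != 0]) :
  (\int[lebesgue_measure]_(t in `[0%R, +oo[)
      ((iota1 b theta (superlevel (fun x => (normc (f x) `^ p)%R) t))%:E
       + (2^-1)%:E
         * weight b (boundary (superlevel (fun x => (normc (f x) `^ p)%R) t)))
   <= (Num.sqrt (p ^+ 2 + 1) / 2)%:E
      * \esum_(e in [set: X * X])
          (b e.1 e.2 * normc (f e.1 - expi (theta e.1 e.2) * f e.2)
           * ((normc (f e.1) `^ p + normc (f e.2) `^ p) / 2) `^ ((p - 1) / p))%:E)%E.
Proof.
have b0 := graph_ge0 hb.
have p0 : p != 0 by rewrite gt_eqF// (lt_le_trans _ hp).
pose g x := normc (f x) `^ p.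
have g0 x : 0 <= g x by exact: powR_ge0.
have gf x : f x = 0 -> g x = 0 by rewrite /g => ->; rewrite normc0 powR0.
pose k := edge_layer theta f g.
pose D : set (measurableTypeR R) := `[0%R, +oo[%classic.
have mD : measurable D by exact: measurable_itv.
have k0 e t : 0 <= k e t by apply: layer_ge0; exact: normc_ge0.
have mk e : measurable_fun D (k e) by exact: measurable_layer.
have intk e : (\int[lebesgue_measure]_(t in D) (k e t)%:E =
    (normc (phase (f e.1) - expi (theta e.1 e.2) * phase (f e.2))
       * Num.min (g e.1) (g e.2)
     + (Num.max (g e.1) (g e.2) - Num.min (g e.1) (g e.2)))%:E)%E.
  apply: integral_layer; first exact: normc_ge0.
  by rewrite le_min !g0/= ge_min !le_max lexx.
have C0 : 0 <= Num.sqrt (p ^+ 2 + 1) / 2 by rewrite divr_ge0// sqrtr_ge0.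
apply: (@le_trans _ _ (\int[lebesgue_measure]_(t in D)
   \esum_(e in [set: X * X]) ((2^-1 * b e.1 e.2)%:E * (k e t)%:E))%E).
  apply: ge0_le_integral_nonmeasurable => t; rewrite /D /= in_itv/= andbT => t0.
    rewrite adde_ge0 ?lee_fin ?iota1_ge0//.
      exact: (finite_superlevel hf gf).
    by rewrite mule_ge0// esum_ge0// => e _; rewrite lee_fin.
  exact: iota1_boundary_le_layers.
rewrite (@integral_esum_finite_range _ _ _ lebesgue_measure _ _
  (fun e => 2^-1 * b e.1 e.2) k)//; last 3 first.
- by move=> e; rewrite mulr_ge0.
- exact: finite_edge_layers.
- by move=> e; rewrite intk.
rewrite -ge0_esumZl//; last first.
  by move=> e; rewrite lee_fin !mulr_ge0 ?normc_ge0 ?powR_ge0.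
apply: le_esum => -[x y] _; rewrite intk -!EFinM lee_fin /=.
set s := Num.sqrt _.
rewrite [leRHS](_ : _ = 2^-1 * b x y * (s * (normc (f x - expi (theta x y) * f y)
  * ((g x + g y) / 2) `^ ((p - 1) / p)))); last by rewrite /g; ring.
rewrite ler_wpM2l ?mulr_ge0//.
exact: edge_le.
Qed.
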